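(* Let $n,N$ be positive integers and let $f_{\mathrm{lock}}, f_{\mathrm{unlock}}\colon [n]\to[0,N-1]$ be two combinations with $f_{\mathrm{lock}}\neq f_{\mathrm{unlock}}$. Let $f^{\mathrm{diff}}$, $\Delta f^{\mathrm{diff}}$, $\Delta_+$, $\Delta_-$ and the enumerations $i_1^{\pm},\dots,i_{\#\Delta_\pm}^{\pm}$ be as defined in the context. Then the optimal (minimal) value of the problem \begin{align*} \text{minimize}\quad & \sum_{j=1}^{m}|c_j|\\ \text{subject to}\quad & f_{\mathrm{unlock}}(i)\equiv f_{\mathrm{lock}}(i)+\sum_{j=1}^{m}c_j\mathbf{1}_{[a_j,b_j]}(i)\pmod N,\quad i\in[n],\\ & m\in\mathbb{N},\ a_j,b_j\in[n]\text{ and }c_j\in\mathbb{Z}\text{ for } j\in[m], \end{align*} is equal to \[ \frac12\sum_{i=0}^{n}|\Delta f^{\mathrm{diff}}(i)|-\sum_{k=1}^{K}\big(|\Delta f^{\mathrm{diff}}(i_k^+)|+|\Delta f^{\mathrm{diff}}(i_k^-)|-N\big)_+, \] where $K=\min\{\#\Delta_+,\#\Delta_-\}$ and $x_+=\max\{x,0\}$.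
   Context: Notation: $\mathbb{N}=\{1,2,\dots\}$; $[m]=\{1,2,\dots,m\}$ for $m\in\mathbb{N}$; $[0,m]=\{0,1,\dots,m\}$ for $m\in\mathbb{N}\cup\{0\}$; for $a,b\in[n]$, $[a,b]=\{i\in[n]\colon a\le i\le b\}$, and $\mathbf{1}_{[a,b]}(i)$ is $1$ if $i\in[a,b]$ and $0$ otherwise. $\#A$ denotes the cardinality of $A$. A combination is a function $f\colon[n]\to[0,N-1]$ (the digits shown on $n$ dials). The difference combination is $f^{\mathrm{diff}}\colon[n]\to[0,N-1]$, $f^{\mathrm{diff}}(i)=f_{\mathrm{unlock}}(i)-f_{\mathrm{lock}}(i) \bmod N$ (the representative in $\{0,\dots,N-1\}$), extended by $f^{\mathrm{diff}}(0)=f^{\mathrm{diff}}(n+1)=0$. Its forward difference is $\Delta f^{\mathrm{diff}}\colon[0,n]\to\mathbb{Z}$, $\Delta f^{\mathrm{diff}}(i)=f^{\mathrm{diff}}(i+1)-f^{\mathrm{diff}}(i)$ (an integer difference, not reduced modulo $N$). Put \[ \Delta_+=\{i\in[0,n]\colon\Delta f^{\mathrm{diff}}(i)>0\},\qquad \Delta_-=\{i\in[0,n]\colon\Delta f^{\mathrm{diff}}(i)<0\}, \] and enumerate each set nonincreasingly by size of the jump: $\Delta_+=\{i_1^+,\dots,i_{\#\Delta_+}^+\}$ with $|\Delta f^{\mathrm{diff}}(i_1^+)|\ge\cdots\ge|\Delta f^{\mathrm{diff}}(i_{\#\Delta_+}^+)|$, and $\Delta_-=\{i_1^-,\dots,i_{\#\Delta_-}^-\}$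 with $|\Delta f^{\mathrm{diff}}(i_1^-)|\ge\cdots\ge|\Delta f^{\mathrm{diff}}(i_{\#\Delta_-}^-)|$. *)

(* Defs.v *)
(* World: MathComp. *)
From HB Require Import structures.
From mathcomp Require Import all_boot all_order all_algebra.

Set Implicit Arguments.
Unset Strict Implicit.
Unset Printing Implicit Defensive.

Import Order.TTheory GRing.Theory Num.Theory.
Local Open Scope ring_scope.

(* The dials [n] = {1, ..., n} are indexed by 'I_n: the ordinal of value i is
   dial i + 1. *)
Definition combination (n N : nat) := {ffun 'I_n -> 'I_N}.

(* For N > 0, (_ %% N)%Z is the representative in {0, ..., N - 1}. *)
Definition fdiff (n N : nat) (flock funlock : combination n N) (i : 'I_n) : int :=
  (((funlock i)%:Z - (flock i)%:Z) %% N%:Z)%Z.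

(* Indexed by the dial number k in {0, ..., n + 1}: 0 at k = 0 and k = n + 1,
   and fdiff at the ordinal k - 1 in between. *)
Definition fdiff_ext (n N : nat) (flock funlock : combination n N) (k : nat) : int :=
  if k is i.+1 then oapp (fdiff flock funlock) 0 (insub i : option 'I_n) else 0.

(* Here the ordinal i : 'I_n.+1 stands for i itself in {0, ..., n}. *)
Definition jump (n N : nat) (flock funlock : combination n N) (i : 'I_n.+1) : int :=
  fdiff_ext flock funlock i.+1 - fdiff_ext flock funlock i.

Definition jumps_pos (n N : nat) (flock funlock : combination n N) : {set 'I_n.+1} :=
  [set i | 0 < jump flock funlock i].

Definition jumps_neg (n N : nat) (flock funlock : combination n N) : {set 'I_n.+1} :=
  [set i | jump flock funlock i < 0].

Definition enumerates_nonincreasing (n N : nat) (flock funlock : combination n N)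
    (A : {set 'I_n.+1}) (s : seq 'I_n.+1) : Prop :=
  perm_eq s (enum A) /\
  sorted (fun i j => `|jump flock funlock j| <= `|jump flock funlock i|) s.

(* [a j, b j] is empty when b j < a j. *)
Definition feasible (n N : nat) (flock funlock : combination n N)
    (m : nat) (a b : 'I_m -> 'I_n) (c : 'I_m -> int) : Prop :=
  (0 < m)%N /\
  forall i : 'I_n,
    ((funlock i)%:Z =
       (flock i)%:Z + \sum_(j < m) c j * (a j <= i <= b j)%N%:R %[mod N%:Z])%Z.

Definition feasible_cost (n N : nat) (flock funlock : combination n N) (x : rat) : Prop :=
  exists (m : nat) (a b : 'I_m -> 'I_n) (c : 'I_m -> int),
    feasible flock funlock a b c /\ x = (\sum_(j < m) `|c j|)%:~R.

Definition is_minimum (S : rat -> Prop) (v : rat) : Prop :=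
  S v /\ forall x : rat, S x -> v <= x.

Definition pos_part (x : int) : int := Num.max x 0.

(* Main.v *)
Require Import Defs.
From HB Require Import structures.
From mathcomp Require Import all_boot all_order all_algebra.
From mathcomp Require Import zify ring lra.

Set Implicit Arguments.
Unset Strict Implicit.
Unset Printing Implicit Defensive.

Import Order.TTheory GRing.Theory Num.Theory.
Local Open Scope ring_scope.

(* A choice of intervals has a profile g with g = f^diff (mod N), and the
   cheapest way to produce a given g costs half the total variation of g.  So
   one minimises 1/2 sum_i |d_i + N e_i| over integers e_i of sum 0, where d is
   the jump function.  Upper bound: take e = -1 and e = +1 at the k-th largest
   positive and negative jumps whenever their sizes add up to more than N.
   Lower bound: the constraint sum_i e_i = 0 gets a Lagrange multiplier N - 2r;
   each |d_i + N e| - (N - 2r) e is minimised over e separately, and a suitable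
   threshold r makes the resulting bound match. *)

Definition excess (N : int) (s t : seq int) : int :=
  \sum_(u <- zip s t) pos_part (u.1 + u.2 - N).

Lemma sum_pos_part_eq0 (s : seq int) (x : int) :
  all (fun y => y <= x) s -> \sum_(y <- s) pos_part (y - x) = 0.
Proof.
move=> /allP s_le; rewrite big_seq big1 // => y /s_le; rewrite /pos_part; lia.
Qed.

(* The bounds P and Q only serve the induction: they keep the threshold of the
   tails on the right side of the heads. *)
Lemma exists_threshold (N P Q : int) (s t : seq int) :
  sorted >=%R s -> sorted >=%R t -> all (fun x => x <= P) s ->
  all (fun y => y <= Q) t -> N <= P + Q ->
  exists2 r : int, N - P <= r <= Q &
    \sum_(x <- s) pos_part (x - (N - r)) + \sum_(y <- t) pos_part (y - r)
      <= excess N s t.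
Proof.
rewrite /excess; elim: s t P Q => [|x s IHs] [|y t] P Q.
- by move=> _ _ _ _ PQ; exists Q; [lia | rewrite /= !big_nil].
- move=> _ _ _ t_le PQ; exists Q; first lia.
  by rewrite !sum_pos_part_eq0 //= big_nil.
- move=> _ _ s_le _ PQ; exists (N - P); first lia.
  by rewrite subKr !sum_pos_part_eq0 //= big_nil.
have ge_trans : transitive (>=%R : rel int) by move=> b a c ab bc; apply: le_trans bc ab.
move=> s_sorted t_sorted /= /andP[xP sP] /andP[yQ tQ] PQ.
have s_le := order_path_min ge_trans s_sorted.
have t_le := order_path_min ge_trans t_sorted.
have [xy | xy] := leP N (x + y).
  have [r r_itv IH] := IHs t x y (path_sorted s_sorted) (path_sorted t_sorted) s_le t_le xy.
  exists r; first lia.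
  rewrite !big_cons /=.
  have -> : pos_part (x + y - N) = pos_part (x - (N - r)) + pos_part (y - r).
    by rewrite /pos_part; lia.
  by rewrite addrACA lerD2l.
exists (Num.max y (N - P)); first lia.
rewrite !sum_pos_part_eq0; last first.
- by rewrite /=; apply/andP; split; [lia | apply: sub_all s_le => z /=; lia].
- by rewrite /=; apply/andP; split; [lia | apply: sub_all t_le => z /=; lia].
by rewrite addr0 sumr_ge0 // => u _; rewrite /pos_part; lia.
Qed.

Lemma dual_bound (N r d e : int) : 0 <= r <= N -> - N <= d <= N ->
  (N - 2 * r) * e + `|d| - 2 * (pos_part (d - (N - r)) + pos_part (- d - r))
    <= `|d + N * e|.
Proof.
rewrite /pos_part => r_itv d_itv.
have [e0 | e0] := leP 0 e; first have [-> | e1] := eqVneq e 0; [lia | |].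
  have : 1 <= e by lia.
  by nia.
have : e <= -1 by lia.
by nia.
Qed.

Lemma sumrD2 (I : finType) (F : I -> int) (i j : I) : i != j ->
  \sum_k F k = F i + F j + \sum_(k | (k != i) && (k != j)) F k.
Proof. by move=> ij; rewrite (bigD1 i) //= (bigD1 j) /= 1?eq_sym // addrA. Qed.

Lemma shift_paired_jumps (I : finType) (N : int) (D : I -> int) (s t : seq I) :
  uniq s -> uniq t -> {in s, forall i, 0 < D i <= N} ->
  {in t, forall i, - N <= D i < 0} ->
  exists D' : I -> int, [/\ \sum_i D' i = \sum_i D i,
    forall i, (D' i = D i %[mod N])%Z &
    \sum_i `|D' i| <= \sum_i `|D i|
       - 2 * excess N [seq `|D i| | i <- s] [seq `|D i| | i <- t]].
Proof.
rewrite /excess; elim: s t D => [|i s IHs] [|j t] D.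
1-3: by exists D; split=> //=; rewrite big_nil; lia.
rewrite /= => /andP[is' s_uniq] /andP[jt t_uniq] sD tD.
have [iD jD] := (sD i (mem_head i s), tD j (mem_head j t)).
have s'D : {in s, forall k, 0 < D k <= N} by move=> k ks; apply: sD; rewrite inE ks orbT.
have t'D : {in t, forall k, - N <= D k < 0} by move=> k ks; apply: tD; rewrite inE ks orbT.
have ij : i != j by apply: contraTneq iD => ->; lia.
have [le_sum | gt_sum] := leP (`|D i| + `|D j|) N.
  have [D' [sumD' modD' normD']] := IHs t D s_uniq t_uniq s'D t'D.
  exists D'; split=> //; rewrite big_cons /=.
  have -> : pos_part (`|D i| + `|D j| - N) = 0 by rewrite /pos_part; lia.
  by rewrite add0r.
pose D1 k := if k == i then D i - N else if k == j then D j + N else D k.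
have D1s : {in s, D1 =1 D}.
  move=> k ks; rewrite /D1; have [k_i | _] := eqVneq k i; first by rewrite -k_i ks in is'.
  by have [k_j | //] := eqVneq k j; have := s'D _ ks; rewrite k_j; lia.
have D1t : {in t, D1 =1 D}.
  move=> k kt; rewrite /D1; have [k_i | _] := eqVneq k i.
    by have := t'D _ kt; rewrite k_i; lia.
  by have [k_j | //] := eqVneq k j; rewrite -k_j kt in jt.
have sD1 : {in s, forall k, 0 < D1 k <= N} by move=> k ks; rewrite D1s ?s'D.
have tD1 : {in t, forall k, - N <= D1 k < 0} by move=> k ks; rewrite D1t ?t'D.
have [D' [sumD' modD' normD']] := IHs t D1 s_uniq t_uniq sD1 tD1.
have D1i : D1 i = D i - N by rewrite /D1 eqxx.
have D1j : D1 j = D j + N by rewrite /D1 eq_sym (negPf ij) eqxx.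
have D1k k : (k != i) && (k != j) -> D1 k = D k.
  by case/andP=> /negPf ki /negPf kj; rewrite /D1 ki kj.
exists D'; split.
- rewrite sumD' !(sumrD2 _ ij) D1i D1j (eq_bigr _ D1k). ring.
- move=> k; rewrite modD' /D1; case: eqP => [-> | _]; first by rewrite -[LHS]modzDr subrK.
  by case: eqP => [-> | _] //; rewrite modzDr.
- rewrite big_cons /=; apply: le_trans normD' _.
  have -> : [seq `|D1 k| | k <- s] = [seq `|D k| | k <- s].
    by apply/eq_in_map => k k_in; rewrite D1s.
  have -> : [seq `|D1 k| | k <- t] = [seq `|D k| | k <- t].
    by apply/eq_in_map => k k_in; rewrite D1t.
  rewrite !(sumrD2 _ ij) D1i D1j.
  have -> : \sum_(k | (k != i) && (k != j)) `|D1 k|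
          = \sum_(k | (k != i) && (k != j)) `|D k|.
    by apply: eq_bigr => k /D1k ->.
  set S0 := \sum_(k | _) _; set S1 := \sum_(u <- _) _.
  move: S0 S1 => S0 S1; rewrite /pos_part; lia.
Qed.

Lemma sum_delta (I : finType) (P : pred I) (p : I) :
  \sum_(k | P k) (k == p)%:R = (P p)%:R :> int.
Proof.
rewrite big_mkcond (bigD1 p) //= eqxx big1 ?addr0; first by case: (P p).
by move=> k /negPf ->; case: ifP.
Qed.

Lemma ex_opposite_signs (I : finType) (D : I -> int) (i : I) :
  \sum_k D k = 0 -> D i != 0 -> exists j, D i * D j < 0.
Proof.
move=> sumD Di; apply/existsP; rewrite -[[exists _, _]]negbK negb_exists.
apply/negP => /forallP DiD.
have : 0 < D i * D i + \sum_(k | k != i) D i * D k.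
  apply: ltr_wpDr; last by rewrite -expr2 exprn_even_gt0.
  by apply: sumr_ge0 => k _; rewrite leNgt.
have -> : D i * D i + \sum_(k | k != i) D i * D k = \sum_k D i * D k.
  by rewrite [RHS](bigD1 i).
by rewrite -mulr_sumr sumD mulr0.
Qed.

Lemma interval_decomposition (n : nat) (D : 'I_n.+1 -> int) :
  \sum_k D k = 0 -> exists L : seq ('I_n * 'I_n * int),
    2 * \sum_(u <- L) `|u.2| = \sum_k `|D k| /\
    forall i : 'I_n, \sum_(u <- L) u.2 * (u.1.1 <= i <= u.1.2)%N%:R
                     = \sum_(k : 'I_n.+1 | (k <= i)%N) D k.
Proof.
have [s] := ubnP (absz (\sum_k `|D k|)); elim: s D => // s IHs D normD sumD.
have [/existsP[i0 Di0] | /existsPn D0] := boolP [exists i, D i != 0]; last first.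
  exists [::]; split=> [|i]; rewrite big_nil ?mulr0 big1 // => k _;
    by move/negPn/eqP: (D0 k) => ->.
have [p [q [lt_pq Dpq]]] : exists p q : 'I_n.+1, (p < q)%N /\ D p * D q < 0.
  have [j0 Dij] := ex_opposite_signs sumD Di0.
  have [ij | ji | /val_inj ij] := ltngtP i0 j0.
  - by exists i0, j0.
  - by exists j0, i0; rewrite mulrC.
  - by move: Dij; rewrite -ij -expr2 ltNge sqr_ge0.
pose c := sgz (D p).
have signs : c = 1 /\ 0 < D p /\ D q < 0 \/ c = -1 /\ D p < 0 /\ 0 < D q.
  rewrite /c; move: Dpq; case: (sgzP (D p)) => [->|Dp|Dp]; first by rewrite mul0r.
  - by rewrite pmulr_rlt0 //; left.
  - by rewrite nmulr_rlt0 //; right.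
pose D' k := D k + c * ((k == q)%:R - (k == p)%:R).
have sumD'P (P : pred 'I_n.+1) :
    \sum_(k | P k) D' k = \sum_(k | P k) D k + c * ((P q)%:R - (P p)%:R).
  by rewrite big_split /= -mulr_sumr sumrB !sum_delta.
have sumD' : \sum_k D' k = 0 by rewrite sumD'P sumD; lia.
have pq : p != q by apply: contraTneq lt_pq => ->; rewrite ltnn.
have normD' : \sum_k `|D' k| = \sum_k `|D k| - 2.
  rewrite !(sumrD2 _ pq).
  have -> : \sum_(k | (k != p) && (k != q)) `|D' k|
          = \sum_(k | (k != p) && (k != q)) `|D k|.
    by apply: eq_bigr => k /andP[/negPf kp /negPf kq]; rewrite /D' kp kq; congr `|_|; lia.
  set S0 := \sum_(k | _) _; move: S0 => S0.
  rewrite /D' !eqxx [q == p]eq_sym (negPf pq).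
  by case: signs => -[-> [Dp Dq]]; lia.
have normD'_ge0 : 0 <= \sum_k `|D' k| by apply: sumr_ge0.
have [|L [costL prefL]] := IHs D' _ sumD'; first by move: normD; rewrite normD'; lia.
have lt_pn : (p < n)%N by have := ltn_ord q; lia.
have lt_qn : (q.-1 < n)%N by have := ltn_ord q; lia.
exists ((Ordinal lt_pn, Ordinal lt_qn, c) :: L); split=> [|i].
  rewrite big_cons mulrDr costL normD' /=.
  have -> : `|c| = 1 by case: signs => -[-> _].
  by rewrite mulr1 addrC subrK.
rewrite big_cons prefL sumD'P /= addrCA -mulrDr.
have -> : (p <= i <= q.-1)%N%:R + ((q <= i)%N%:R - (p <= i)%N%:R) = 0 :> int by lia.
by rewrite mulr0 addr0.
Qed.

Lemma telescope_sumr_ord (F : nat -> int) (n : nat) :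
  \sum_(k < n) (F k.+1 - F k) = F n - F 0%N.
Proof. by rewrite -(big_mkord predT (fun k => F k.+1 - F k)) telescope_sumr. Qed.

Lemma telescope_sumr_ord_prefix (F : nat -> int) (n m : nat) : (m <= n)%N ->
  \sum_(k < n | (k < m)%N) (F k.+1 - F k) = F m - F 0%N.
Proof.
move=> le_mn; rewrite -(big_ord_widen n (fun k => F k.+1 - F k) le_mn).
exact: telescope_sumr_ord.
Qed.

Section Combinations.

Variables (n N : nat) (flock funlock : combination n N).
Hypothesis N_gt0 : (0 < N)%N.

Let d := jump flock funlock.

Lemma fdiff_extS (i : 'I_n) : fdiff_ext flock funlock i.+1 = fdiff flock funlock i.
Proof. by rewrite /= valK. Qed.

Lemma fdiff_ext_last : fdiff_ext flock funlock n.+1 = 0.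
Proof. by rewrite /= insubF ?ltnn. Qed.

Lemma fdiff_ext_bound (k : nat) : 0 <= fdiff_ext flock funlock k < N%:Z.
Proof.
have N0 : N%:Z != 0 by lia.
case: k => [|k] /=; first lia.
by case: insubP => [i _ _|_] /=; [rewrite modz_ge0 // ltz_pmod | lia].
Qed.

Lemma jump_bound (i : 'I_n.+1) : - N%:Z <= d i <= N%:Z.
Proof. by have := fdiff_ext_bound i.+1; have := fdiff_ext_bound i; rewrite /d /jump; lia. Qed.

Lemma sum_jump_prefix (i : 'I_n) :
  \sum_(k : 'I_n.+1 | (k <= i)%N) d k = fdiff flock funlock i.
Proof.
by rewrite (telescope_sumr_ord_prefix (fdiff_ext flock funlock) (m := i.+1)) ?fdiff_extS ?subr0 // ltnS ltnW.
Qed.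

Lemma sum_jump : \sum_k d k = 0.
Proof.
by rewrite telescope_sumr_ord fdiff_ext_last subr0.
Qed.

Lemma fdiff_mod (i : 'I_n) (x : int) :
  ((funlock i)%:Z = (flock i)%:Z + x %[mod N%:Z])%Z <->
  (x = fdiff flock funlock i %[mod N%:Z])%Z.
Proof.
rewrite /fdiff modz_mod.
have -> : (x = (funlock i)%:Z - (flock i)%:Z %[mod N%:Z])%Z <->
          (x == - (flock i)%:Z + (funlock i)%:Z %[mod N%:Z])%Z.
  by rewrite [- _ + _]addrC; split=> /eqP.
rewrite -(eqz_modDl (flock i)%:Z x) addrA subrr add0r eq_sym.
by split=> /eqP.
Qed.

Lemma cost_lower_bound (m : nat) (a b : 'I_m -> 'I_n) (c : 'I_m -> int)
    (s t : seq 'I_n.+1) :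
  feasible flock funlock a b c ->
  enumerates_nonincreasing flock funlock (jumps_pos flock funlock) s ->
  enumerates_nonincreasing flock funlock (jumps_neg flock funlock) t ->
  \sum_k `|d k| - 2 * excess N%:Z [seq `|d k| | k <- s] [seq `|d k| | k <- t]
    <= 2 * \sum_j `|c j|.
Proof.
move=> [_ feas] [s_enum s_sorted] [t_enum t_sorted].
pose G (k : nat) : int := \sum_j c j * (a j < k <= (b j).+1)%N%:R.
pose h k := ((G k - fdiff_ext flock funlock k) %/ N%:Z)%Z.
have G0 : G 0%N = 0 by rewrite /G big1 // => j _; rewrite mulr0.
have Glast : G n.+1 = 0.
  rewrite /G big1 // => j _; suff -> : (a j < n.+1 <= (b j).+1)%N = false by rewrite mulr0.
  by have := ltn_ord (b j); lia.
have GE k : (k <= n.+1)%N -> G k = fdiff_ext flock funlock k + N%:Z * h k.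
  move=> le_kn; rewrite mulrC divzK; first by rewrite addrC subrK.
  case: k le_kn => [|k]; first by rewrite G0 subrr dvdz0.
  rewrite ltnS leq_eqVlt => /predU1P[-> | lt_kn].
    by rewrite Glast fdiff_ext_last subrr dvdz0.
  have [+ _] := fdiff_mod (Ordinal lt_kn) (G k.+1).
  rewrite -fdiff_extS -eqz_mod_dvd => modE.
  by apply/eqP/modE; rewrite feas.
have GdE (k : 'I_n.+1) : G k.+1 - G k = d k + N%:Z * (h k.+1 - h k).
  by rewrite !GE ?ltn_ord 1?ltnW ?ltn_ord // /d /jump; ring.
have sum_h : \sum_(k < n.+1) (h k.+1 - h k) = 0.
  by rewrite telescope_sumr_ord /h Glast G0 fdiff_ext_last subrr.
have cost_ge : \sum_(k < n.+1) `|G k.+1 - G k| <= 2 * \sum_j `|c j|.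
  rewrite mulr_sumr.
  apply: (@le_trans _ _ (\sum_(k < n.+1) \sum_j
      `|c j| * ((k == inord (a j))%:R + (k == inord (b j).+1)%:R))).
    apply: ler_sum => k _; rewrite -sumrB; apply: le_trans (ler_norm_sum _ _ _) _.
    apply: ler_sum => j _; rewrite -mulrBr normrM ler_wpM2l //.
    rewrite -!val_eqE /= !inordK ?ltnS ?ltn_ord //; last by rewrite ltnW ?ltn_ord.
    lia.
  rewrite exchange_big; apply: ler_sum => j _ /=.
  by rewrite -mulr_sumr big_split /= !sum_delta mulrC.
have ge_norms (u : seq 'I_n.+1) :
    sorted (fun i j => `|d j| <= `|d i|) u -> sorted >=%R [seq `|d k| | k <- u].
  by rewrite sorted_map.
have le_norms (u : seq 'I_n.+1) : all (fun x => x <= N%:Z) [seq `|d k| | k <- u].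
  by rewrite all_map; apply/allP => k _ /=; have := jump_bound k; lia.
have NN : N%:Z <= N%:Z + N%:Z by lia.
have [r r_itv excess_ge] := exists_threshold (ge_norms _ s_sorted) (ge_norms _ t_sorted)
  (le_norms s) (le_norms t) NN.
have sE : \sum_(x <- [seq `|d k| | k <- s]) pos_part (x - (N%:Z - r))
        = \sum_k pos_part (d k - (N%:Z - r)).
  rewrite big_map (perm_big _ s_enum) big_enum big_mkcond; apply: eq_bigr => k _.
  by rewrite inE /pos_part -/d; case: ifP; lia.
have tE : \sum_(x <- [seq `|d k| | k <- t]) pos_part (x - r)
        = \sum_k pos_part (- d k - r).
  rewrite big_map (perm_big _ t_enum) big_enum big_mkcond; apply: eq_bigr => k _.
  by rewrite inE /pos_part -/d; case: ifP; lia.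
rewrite sE tE -big_split /= in excess_ge.
have dual_ge : \sum_(k < n.+1) ((N%:Z - 2 * r) * (h k.+1 - h k) + `|d k|
     - 2 * (pos_part (d k - (N%:Z - r)) + pos_part (- d k - r)))
    <= \sum_(k < n.+1) `|G k.+1 - G k|.
  by apply: ler_sum => k _; rewrite GdE dual_bound ?jump_bound //; lia.
rewrite sumrB big_split /= -!mulr_sumr sum_h mulr0 add0r in dual_ge.
apply: le_trans (le_trans dual_ge cost_ge).
by rewrite lerD2l lerN2 ler_pM2l.
Qed.

Lemma attained_cost (s t : seq 'I_n.+1) : (0 < n)%N ->
  uniq s -> uniq t -> {subset s <= jumps_pos flock funlock} ->
  {subset t <= jumps_neg flock funlock} ->
  exists (m : nat) (a b : 'I_m -> 'I_n) (c : 'I_m -> int),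
    feasible flock funlock a b c /\
    2 * \sum_j `|c j| <= \sum_k `|d k|
      - 2 * excess N%:Z [seq `|d k| | k <- s] [seq `|d k| | k <- t].
Proof.
move=> n_gt0 s_uniq t_uniq s_pos t_neg.
have sd : {in s, forall k, 0 < d k <= N%:Z}.
  by move=> k /s_pos; rewrite inE => ->; have := jump_bound k; lia.
have td : {in t, forall k, - N%:Z <= d k < 0}.
  by move=> k /t_neg; rewrite inE => ->; have := jump_bound k; lia.
have [D [sumD modD normD]] := shift_paired_jumps s_uniq t_uniq sd td.
have [|L [costL prefL]] := interval_decomposition (D := D); first by rewrite sumD sum_jump.
(* The null interval only serves to make the number of intervals positive. *)
pose L0 := (Ordinal n_gt0, Ordinal n_gt0, 0 : int) :: L.
pose u (j : 'I_(size L0)) := tnth (in_tuple L0) j.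
have sumL0 (F : 'I_n * 'I_n * int -> int) : F (Ordinal n_gt0, Ordinal n_gt0, 0) = 0 ->
    \sum_j F (u j) = \sum_(v <- L) F v.
  by move=> F0; rewrite -(big_tnth _ _ L0 predT F) big_cons F0 add0r.
exists (size L0), (fun j => (u j).1.1), (fun j => (u j).1.2), (fun j => (u j).2).
split; last by rewrite (sumL0 (fun v => `|v.2|)) // costL.
split=> // i; apply/fdiff_mod.
rewrite (sumL0 (fun v => v.2 * (v.1.1 <= i <= v.1.2)%N%:R)) ?mul0r // prefL.
rewrite -sum_jump_prefix; apply/eqP; rewrite eqz_mod_dvd -sumrB.
by apply: rpred_sum => k _; rewrite -eqz_mod_dvd modD.
Qed.

End Combinations.

Theorem theorem1 (n N : nat) (n_gt0 : (0 < n)%N) (N_gt0 : (0 < N)%N)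
    (flock funlock : combination n N) (lock_neq_unlock : flock <> funlock)
    (ipos ineg : seq 'I_n.+1)
    (ipos_enum :
      enumerates_nonincreasing flock funlock (jumps_pos flock funlock) ipos)
    (ineg_enum :
      enumerates_nonincreasing flock funlock (jumps_neg flock funlock) ineg) :
  is_minimum (feasible_cost flock funlock)
    (1 / 2 * (\sum_(i < n.+1) `|jump flock funlock i|)%:~R
     - (\sum_(k < minn #|jumps_pos flock funlock| #|jumps_neg flock funlock|)
          pos_part (`|jump flock funlock (nth ord0 ipos k)|
                    + `|jump flock funlock (nth ord0 ineg k)| - N%:Z))%:~R).
Proof.
have [[pos_perm _] [neg_perm _]] := (ipos_enum, ineg_enum).
pose d := jump flock funlock.
set A := \sum_i _; set B := \sum_k _.
have BE : B = excess N%:Z [seq `|d k| | k <- ipos] [seq `|d k| | k <- ineg].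
  rewrite /B /excess !cardE -(perm_size pos_perm) -(perm_size neg_perm).
  rewrite (big_nth (0, 0)) size_zip !size_map big_mkord; apply: eq_bigr => k _.
  have [k_pos k_neg] : (k < size ipos)%N /\ (k < size ineg)%N.
    by apply/andP; rewrite -leq_min ltn_ord.
  by rewrite nth_zip_cond size_zip !size_map ltn_ord /= !(nth_map ord0).
have valueE (C : int) : (1 / 2 * A%:~R - B%:~R <= C%:~R :> rat) = (A - 2 * B <= 2 * C).
  by rewrite -(ler_int rat) !rmorphB !rmorphM /=; apply/idP/idP; lra.
have lower x : feasible_cost flock funlock x -> 1 / 2 * A%:~R - B%:~R <= x.
  move=> [m [a [b [c [feas ->]]]]]; rewrite valueE BE.
  exact: cost_lower_bound feas ipos_enum ineg_enum.
split=> //.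
have pos_uniq : uniq ipos by rewrite (perm_uniq pos_perm) enum_uniq.
have neg_uniq : uniq ineg by rewrite (perm_uniq neg_perm) enum_uniq.
have pos_sub : {subset ipos <= jumps_pos flock funlock}.
  by move=> k; rewrite (perm_mem pos_perm) mem_enum.
have neg_sub : {subset ineg <= jumps_neg flock funlock}.
  by move=> k; rewrite (perm_mem neg_perm) mem_enum.
have [m [a [b [c [feas cost_le]]]]] :=
  attained_cost N_gt0 n_gt0 pos_uniq neg_uniq pos_sub neg_sub.
exists m, a, b, c; split=> //; apply/eqP; rewrite eq_le lower /=; last by exists m, a, b, c.
have : 2 * (\sum_j `|c j|) <= A - 2 * B by rewrite BE.
by rewrite -(ler_int rat) !rmorphB !rmorphM /=; lra.
Qed.
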